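(* Let $B$ be a complete boolean algebra. Then the poset $\mathcal{NO}(B)$ of necessity operators on $B$ is a zero-dimensional frame, and this frame is spatial if and only if $B$ is atomic.
   Context: A necessity operator on a boolean algebra $B$ is a function $\Box\colon B\to B$ preserving finite meets (including the empty meet, so $\Box 1=1$). $\mathcal{NO}(B)$ is the set of necessity operators on $B$, ordered pointwise: $f\le g$ iff $f(a)\le g(a)$ for all $a\in B$. A frame is a complete lattice $L$ satisfying $a\wedge\bigvee S=\bigvee\{a\wedge b\mid b\in S\}$ for all $a\in L$, $S\subseteq L$. A frame is zero-dimensional if each of its elements is a join of complemented elements. A frame is spatial if it is isomorphic to the frame of open sets of a topological space. *)

(* Defs.v *)
From HB Require Import structures.
From mathcomp Require Import all_boot all_order.
From mathcomp Require Import boolp classical_sets topology.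

Set Implicit Arguments.
Unset Strict Implicit.
Unset Printing Implicit Defensive.

Import Order.TTheory.
Local Open Scope classical_set_scope.
Local Open Scope order_scope.

(* The empty sequence gives [f \top = \top]. *)
Definition preserves_finite_meets d (B : ctbDistrLatticeType d) (f : B -> B) :=
  forall s : seq B, f (\meet_(x <- s) x) = \meet_(x <- s) f x.

Record necessity_operator d (B : ctbDistrLatticeType d) := NecessityOperator {
  necessity_fun :> B -> B;
  necessity_meets : preserves_finite_meets necessity_fun }.

Section NecessityOrder.
Context d (B : ctbDistrLatticeType d).

HB.instance Definition _ := gen_eqMixin (necessity_operator B).
HB.instance Definition _ := gen_choiceMixin (necessity_operator B).

Definition necessity_le (f g : necessity_operator B) : bool :=
  `[< forall a : B, f a <= g a >].

Fact necessity_le_refl : reflexive necessity_le.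
Proof. by move=> f; apply/asboolP. Qed.

Fact necessity_le_anti : antisymmetric necessity_le.
Proof.
move=> [f fM] [g gM] /andP[/asboolP /= fg /asboolP /= gf].
have E : f = g by apply/funext => a; apply/le_anti; rewrite fg gf.
by case: g / E gM {fg gf} => gM; rewrite (Prop_irrelevance fM gM).
Qed.

Fact necessity_le_trans : transitive necessity_le.
Proof.
move=> g f h /asboolP fg /asboolP gh; apply/asboolP => a.
exact: le_trans (fg a) (gh a).
Qed.

Fact necessity_display (disp : Order.disp_t) : Order.disp_t.
Proof. exact: disp. Qed.

HB.instance Definition _ := Order.Le_isPOrder.Build (necessity_display d)
  (necessity_operator B) necessity_le_refl necessity_le_anti necessity_le_trans.

Lemma necessity_leP (f g : necessity_operator B) :
  reflect (forall a : B, f a <= g a) (f <= g).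
Proof. exact: asboolP. Qed.

End NecessityOrder.

Section FrameNotions.
Context d (L : porderType d).

Definition complete_lattice :=
  forall S : set L, supremums S !=set0 /\ infimums S !=set0.

(* Joins and meets are described by the relations [supremums] and [infimums],
   since [L] carries only its order. *)
Definition is_frame :=
  complete_lattice /\
  forall (a : L) (S : set L) (s m : L),
    supremums S s -> infimums [set a; s] m ->
    supremums [set c | exists2 b, S b & infimums [set a; b] c] m.

Definition complemented (x : L) :=
  exists y : L, (exists2 b, lbound [set: L] b & infimums [set x; y] b) /\
                (exists2 t, ubound [set: L] t & supremums [set x; y] t).

Definition zero_dimensional :=
  forall x : L, exists2 S : set L, S `<=` complemented & supremums S x.

(* [X] may be empty, as is needed for the one-element frame. *)
Definition spatial :=
  exists (X : topologicalType) (phi : L -> set X),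
    [/\ forall x y : L, x <= y <-> phi x `<=` phi y,
        forall x : L, open (phi x)
      & forall U : set X, open U -> exists x : L, phi x = U].

End FrameNotions.

Arguments complete_lattice {d} L.
Arguments is_frame {d} L.
Arguments zero_dimensional {d} L.
Arguments spatial {d} L.

Section Atomic.
Context d (B : ctbDistrLatticeType d).

Definition atom (a : B) :=
  a <> \bot /\ forall x : B, x <= a -> x = \bot \/ x = a.

Definition atomic := forall b : B, b <> \bot -> exists2 a, atom a & a <= b.

End Atomic.

Arguments atomic {d} B.

(* Main.v *)
(** Joins in [NO(B)] are computed by the formula
    [(\/S) a = sup {f1 b1 /\ .. /\ fn bn | fi \in S, b1 /\ .. /\ bn <= a}];
    replacing each [bi] by [a \/ bi] gives the frame law.  Every [f] is the
    join of the operators sending [\top] to [\top], the other elements above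
    [b] to [f b] and the remaining ones to [\bot]; the complement of such an
    operator can be written down explicitly.

    If [B] is atomic, the points of [NO(B)] are taken to be the pairs of an atom
    [a] and a prime filter [U] of [B], such a pair being in the open set of [f]
    when [a <= f y] for some [y] outside [U].  Conversely, the operators constant
    on the elements other than [\top] form a copy of [B] in [NO(B)], so a point of
    [NO(B)] restricts to a completely prime filter of [B], which is generated by
    an atom. *)
From HB Require Import structures.
From mathcomp Require Import all_boot all_order.
From mathcomp Require Import boolp classical_sets filter topology.
Require Import Defs.

Set Implicit Arguments.
Unset Strict Implicit.
Unset Printing Implicit Defensive.

Import Order.Theory.
Local Open Scope classical_set_scope.
Local Open Scope order_scope.

Lemma supremums_uniq d (T : porderType d) (S : set T) (x y : T) :
  supremums S x -> supremums S y -> x = y.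
Proof.
by move=> [Sx lx] [Sy ly]; apply/le_anti; rewrite (lx _ Sy) (ly _ Sx).
Qed.

(** * Step operators, their complements, and finite terms for joins *)

Section NecessityOperators.
Context d (B : ctbDistrLatticeType d).
Implicit Types (f g h : necessity_operator B) (S : set (necessity_operator B)).
Implicit Types a b c e x y z : B.

Lemma necessity1 f : f \top = \top.
Proof. by have := necessity_meets f [::]; rewrite !big_nil. Qed.

Lemma necessityI f x y : f (x `&` y) = f x `&` f y.
Proof.
by have := necessity_meets f [:: x; y]; rewrite !big_cons !big_nil !meetx1.
Qed.

Lemma necessity_homo f x y : x <= y -> f x <= f y.
Proof. by move=> /meet_l xy; rewrite -[in f x]xy necessityI leIr. Qed.

Lemma preserves_finite_meetsP (f : B -> B) :
  f \top = \top -> {morph f : x y / x `&` y} -> preserves_finite_meets f.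
Proof. by move=> f1 fI s; apply: (big_morph f fI f1). Qed.

(** Joining [c] with [e] keeps this monotone for all [c] and [e]; a nonzero [e] occurs in
    complements. *)
Definition step_fun b c e x :=
  if x == \top then \top else if b <= x then c `|` e else e.

Lemma step_fun_meets b c e : preserves_finite_meets (step_fun b c e).
Proof.
apply: preserves_finite_meetsP => [|x y]; first by rewrite /step_fun eqxx.
rewrite /step_fun lexI; have [->|xN1] := eqVneq x \top.
  by rewrite !meet1x lex1.
have [->|yN1] := eqVneq y \top; first by rewrite !meetx1 lex1 andbT (negbTE xN1).
have -> : (x `&` y == \top) = false.
  apply/negbTE; apply: contra xN1 => /eqP xy1.
  by rewrite -le1x -xy1 leIl.
by case: (b <= x); case: (b <= y); rewrite /= ?meetxx // ?joinKIC // meetC joinKIC.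
Qed.

Definition step b c e := NecessityOperator (step_fun_meets b c e).

Lemma step_le b c e h : h b >= c `|` e -> h \bot >= e -> step b c e <= h.
Proof.
move=> hb h0; apply/necessity_leP => x; rewrite /= /step_fun.
case: eqP => [->|_]; first by rewrite necessity1.
case: ifP => [bx|_]; first exact: le_trans hb (necessity_homo h bx).
exact: le_trans h0 (necessity_homo h (le0x _)).
Qed.

Lemma le_step b c e : c `|` e <= step b c e b.
Proof. by rewrite /= /step_fun lexx; case: eqP; rewrite ?lex1. Qed.

Lemma step_bot b c e x : e <= step b c e x.
Proof.
by rewrite /= /step_fun; case: ifP; rewrite ?lex1 //; case: ifP; rewrite ?leUr.
Qed.

Definition nbot := step \bot \bot \bot.
Definition ntop := step \bot \top \bot.

Lemma nbot_le h : nbot <= h.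
Proof. by apply: step_le; rewrite ?joinxx le0x. Qed.

Lemma le_ntop h : h <= ntop.
Proof.
by apply/necessity_leP => x; rewrite /= /step_fun le0x joinx0 if_same lex1.
Qed.

Lemma nmeet_meets f g : preserves_finite_meets (fun x => f x `&` g x).
Proof.
apply: preserves_finite_meetsP => [|x y]; first by rewrite !necessity1 meetxx.
by rewrite !necessityI meetACA.
Qed.

Definition nmeet f g := NecessityOperator (nmeet_meets f g).

Lemma nmeet_infimums f g : infimums [set f; g] (nmeet f g).
Proof.
split=> [h [->|->]|h lb]; apply/necessity_leP => x /=; rewrite ?leIl ?leIr //.
by rewrite lexI (necessity_leP _ _ (lb f _)) ?(necessity_leP _ _ (lb g _));
  [|right|left].
Qed.

(** Only [\top] lies above both [b] and its complement, so the two operators meet in [nbot]. An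
    upper bound of both exceeds the complement of [c] everywhere, and exceeds [c] at [b] and at the
    complement of [b], hence at their meet [\bot]. *)
Lemma step_complemented b c : complemented (step b c \bot).
Proof.
exists (step (~` b) \top (~` c)); split.
- exists nbot => [h _|]; first exact: nbot_le.
  split=> [h _|h lb]; first exact: nbot_le.
  have /necessity_leP hle1 := lb _ (or_introl erefl).
  have /necessity_leP hle2 := lb _ (or_intror erefl).
  apply/necessity_leP => x; rewrite /= /step_fun.
  have := hle1 x; have := hle2 x; rewrite /= /step_fun.
  case: eqP => // xN1; rewrite le0x joinxx joinx0 join1x.
  case: ifP => bCx; case: ifP => bx //.
    by case: xN1; apply/eqP; rewrite -le1x -(joinxC b) leUx bx.
  by move=> h1 h2; rewrite -(meetxC c) lexI h1 h2.
- exists ntop => [h _|]; first exact: le_ntop.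
  split=> [h _|h ub]; first exact: le_ntop.
  have /necessity_leP leh1 := ub _ (or_introl erefl).
  have /necessity_leP leh2 := ub _ (or_intror erefl).
  have h1 : c <= h b.
    by apply: le_trans (leh1 b); apply: le_trans (le_step _ _ _); rewrite leUl.
  have h2 : \top <= h (~` b).
    by apply: le_trans (leh2 _); apply: le_trans (le_step _ _ _); rewrite leUl.
  have h3 : ~` c <= h \bot by exact: le_trans (step_bot _ _ _ _) (leh2 _).
  apply: step_le; rewrite ?le0x // joinx0 -(joinxC c) leUx h3 andbT.
  by rewrite -(meetxC b) necessityI lexI h1 (le_trans (lex1 c)).
Qed.

Lemma necessity_zero_dimensional : zero_dimensional (necessity_operator B).
Proof.
move=> f; exists [set step b (f b) \bot | b in setT].
  by move=> _ [b _ <-]; exact: step_complemented.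
split=> [_ [b _ <-]|h ub]; first by apply: step_le; rewrite ?joinx0 ?le0x.
apply/necessity_leP => b; have /necessity_leP := ub _ (imageP _ (I : setT b)).
by move/(_ b); apply: le_trans; apply: le_trans (le_step _ _ _); rewrite joinx0.
Qed.

(* [join_term S y c] means that [y = b1 /\ .. /\ bn] and
   [c = f1 b1 /\ .. /\ fn bn] for some [fi] in [S]. *)
Inductive join_term S : B -> B -> Prop :=
| join_term1 : join_term S \top \top
| join_termI f b y c :
    S f -> join_term S y c -> join_term S (b `&` y) (f b `&` c).

Lemma join_term_meet S y z c e :
  join_term S y c -> join_term S z e -> join_term S (y `&` z) (c `&` e).
Proof.
move=> Sy Sz; elim: Sy => [|f b y' c' Sf _ IH]; first by rewrite !meet1x.
by rewrite -!meetA; exact: join_termI.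
Qed.

Lemma join_term_le S h y c : ubound S h -> join_term S y c -> c <= h y.
Proof.
move=> ub; elim=> [|f b y' c' Sf _ IH]; first by rewrite necessity1.
by rewrite necessityI leI2 // (necessity_leP _ _ (ub f Sf)).
Qed.

(** Each factor gets its own copy of [g x]: since [g] is monotone, [g x] and [f b] meet below
    [nmeet g f] at the join of [x] and [b]. Distributivity collects the factors. *)
Lemma join_term_frame S g h x y c :
  ubound [set nmeet g f | f in S] h ->
  join_term S y c -> g x `&` c <= h (x `|` y).
Proof.
move=> ub; elim=> [|f b y' c' Sf _ IH]; first by rewrite joinx1 necessity1 lex1.
rewrite joinIr necessityI lexI; apply/andP; split; last first.
  by apply: le_trans IH; rewrite leI2 // leIr.
apply: le_trans (necessity_leP _ _ (ub _ (imageP _ Sf)) _) => /=.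
rewrite leI2 ?necessity_homo ?leUl //.
by apply: le_trans (leIl _ _) _; rewrite necessity_homo ?leUr.
Qed.

End NecessityOperators.

Arguments nbot {d B}.
Arguments ntop {d B}.

(** * The frame law over a complete algebra, and atoms from points *)

Section Complete.
Context d (B : ctbDistrLatticeType d) (B_complete : complete_lattice B).
Implicit Types (f g h : necessity_operator B) (S : set (necessity_operator B)).
Implicit Types a b c e x y z : B.

Definition bsup (A : set B) : B := xget \bot (supremums A).

Lemma bsupP (A : set B) : supremums A (bsup A).
Proof.
rewrite /bsup; case: xgetP => [x -> //|no].
by case: (B_complete A) => -[x Ax] _; case: (no x).
Qed.

Lemma bsup_ub (A : set B) x : A x -> x <= bsup A.
Proof. by case: (bsupP A) => + _; apply. Qed.

Lemma bsup_le (A : set B) x : ubound A x -> bsup A <= x.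
Proof. by case: (bsupP A) => _; apply. Qed.

(** In a boolean algebra, meeting with [a] has a right adjoint, so it preserves suprema. *)
Lemma meet_bsup_le (A : set B) a e :
  (forall x, A x -> a `&` x <= e) -> a `&` bsup A <= e.
Proof.
move=> Ae; rewrite meetC -[a]complK -diffE leBLR; apply: bsup_le => x Ax.
by rewrite -leBLR diffE complK meetC; exact: Ae.
Qed.

Definition nsup_fun S a := bsup [set c | exists2 y, y <= a & join_term S y c].

Lemma nsup_fun_meets S : preserves_finite_meets (nsup_fun S).
Proof.
apply: preserves_finite_meetsP => [|x z].
  apply/le_anti; rewrite lex1 /=; apply: bsup_ub.
  by exists \top => //; exact: join_term1.
have mono u v : u <= v -> nsup_fun S u <= nsup_fun S v.
  move=> uv; apply: bsup_le => c [y yu Sc]; apply: bsup_ub.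
  by exists y => //; exact: le_trans uv.
apply/le_anti; rewrite lexI !mono ?leIl ?leIr //=.
(* Distributing twice leaves two terms, whose meet is again a term. *)
apply: meet_bsup_le => e [y yz Se]; rewrite meetC.
apply: meet_bsup_le => c [w wx Sc]; rewrite meetC.
by apply: bsup_ub; exists (w `&` y); [exact: leI2 | exact: join_term_meet].
Qed.

Definition nsup S := NecessityOperator (nsup_fun_meets S).

Lemma nsupP S : supremums S (nsup S).
Proof.
split=> [f Sf|h ub]; apply/necessity_leP => a.
  apply: bsup_ub; exists (a `&` \top); first by rewrite meetx1.
  by rewrite -[f a]meetx1; apply: join_termI => //; exact: join_term1.
apply: bsup_le => c [y ya /(join_term_le ub) cy].
exact: le_trans cy (necessity_homo h ya).
Qed.

Lemma necessity_frame : is_frame (necessity_operator B).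
Proof.
split=> [S|g S s m Ss [mlb mglb]].
  split; first by exists (nsup S); exact: nsupP.
  exists (nsup (lbound S)); have [ub lub] := nsupP (lbound S).
  by split=> // f Sf; apply: lub => h; apply.
split=> [c [f Sf [clb _]]|h ub].
  apply: mglb => _ [->|->]; first by apply: clb; left.
  by apply: le_trans (Ss.1 f Sf); apply: clb; right.
have hub : ubound [set nmeet g f | f in S] h.
  by move=> _ [f Sf <-]; apply: ub; exists f => //; exact: nmeet_infimums.
apply/necessity_leP => x.
have mg := necessity_leP _ _ (mlb g (or_introl erefl)) x.
have ms := necessity_leP _ _ (mlb s (or_intror erefl)) x.
apply: (@le_trans _ _ (g x `&` s x)); first by rewrite lexI mg.
rewrite (supremums_uniq Ss (nsupP S)); apply: meet_bsup_le => c [y yx Sc].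
by apply: le_trans (join_term_frame x hub Sc) _; rewrite (join_l yx).
Qed.

Lemma spatial_atomic : spatial (necessity_operator B) -> atomic B.
Proof.
move=> [X [phi [phi_le phi_open phi_surj]]] b /eqP bN0.
(* By [kle] and [lek], [k c] lies below [h] exactly when [c <= h \bot]. *)
pose k c := step \bot c \bot.
have kle c h : c <= h \bot -> k c <= h.
  by move=> ch; apply: step_le; rewrite ?joinx0 ?le0x.
have lek c : c <= k c \bot by rewrite -[leLHS]joinx0; exact: le_step.
have [p [pb pN0]] : exists p, phi (k b) p /\ ~ phi nbot p.
  apply: contrapT => no; have : k b <= nbot.
    apply/phi_le => p pb; apply: contrapT => pN0; apply: no; exists p.
    by split.
  move/necessity_leP/(_ \bot); rewrite /= /step_fun.
  case: eqP => [E|_]; first by have := lex1 b; rewrite -E lex0 (negbTE bN0).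
  by rewrite lexx !joinx0 lex0 (negbTE bN0).
(* The two open sets meet in some [phi h], and [h] lies below [nbot], whose open set misses [p]. *)
have pC c : phi (k c) p -> phi (k (~` c)) p -> False.
  move=> pc pCc; have [h hE] := phi_surj _ (openI (phi_open (k c)) (phi_open (k (~` c)))).
  have hc : h <= k c by apply/phi_le; rewrite hE => q [].
  have hCc : h <= k (~` c) by apply/phi_le; rewrite hE => q [].
  apply: pN0; suff /phi_le : h <= nbot by apply; rewrite hE; split.
  apply/necessity_leP => x; have := necessity_leP _ _ hc x.
  have := necessity_leP _ _ hCc x; rewrite /= /step_fun.
  case: eqP => // _; rewrite le0x !joinx0 => h1 h2.
  by rewrite -(meetxC c) lexI h1 h2.
(* [N] contains its own supremum, since a union of opens is some [phi h]; the complement of [bsup N]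
   is the required atom. *)
pose N := [set c | ~ phi (k c) p].
have NsupN : N (bsup N).
  have /phi_surj[h hE] : open (\bigcup_(c in N) phi (k c)).
    by apply: bigcup_open => c _; exact: phi_open.
  have : k (bsup N) <= h.
    apply: kle; apply: bsup_le => c Nc.
    apply: le_trans (lek c) (necessity_leP _ _ _ _).
    by apply/phi_le; rewrite hE => q; exists c.
  by move=> /phi_le kh /kh; rewrite hE => -[c].
have NC c : phi (k c) p -> ~` c <= bsup N.
  by move=> pc; apply: bsup_ub => /(pC c pc).
have k1 : phi (k \top) p.
  by move: pb; apply: (phi_le _ _).1; apply: kle; apply: le_trans (lek _); exact: lex1.
exists (~` bsup N); last by rewrite leCx; exact: NC.
split=> [E|x xa].
  by apply: NsupN; rewrite -[bsup N]complK E compl0.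
have [px|Nx] := pselect (phi (k x) p).
  by right; apply/le_anti; rewrite xa /= leCx; exact: NC.
left; apply/le_anti; rewrite le0x andbT -(meetCx (bsup N)) lexI xa /=.
exact: bsup_ub.
Qed.

End Complete.

(** * Prime filters of an atomic boolean algebra *)

Section PrimeFilters.
Context d (B : ctbDistrLatticeType d).
Implicit Types a b c e x y z : B.

(** The equivalence for meets also encodes upward closure. *)
Definition prime_filter (U : set B) :=
  [/\ U \top, ~ U \bot, forall x y, U (x `&` y) <-> U x /\ U y
    & forall x y, U (x `|` y) -> U x \/ U y].

Lemma atom_le_or_compl a x : atom a -> a <= x \/ a <= ~` x.
Proof.
move=> [_ aP]; case: (aP (a `&` x) (leIl _ _)) => [/eqP|<-]; last by left; exact: leIr.
by rewrite disj_leC; right.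
Qed.

Definition atoms_below x := [set a : B | atom a /\ a <= x].

(* The filters of [B] correspond to filters of sets of atoms, to which the
   ultrafilter lemma for sets applies. *)
Lemma prime_filter_avoiding (F : set B) x :
  atomic B -> F \top -> (forall y z, F y -> F z -> F (y `&` z)) ->
  (forall y z, y <= z -> F y -> F z) -> ~ F x ->
  exists2 U, prime_filter U & F `<=` U /\ ~ U x.
Proof.
move=> Batomic F1 FI FS Fx.
(* Discarding the atoms below [x] forces the ultrafilter to avoid [x]; the base sets stay nonempty
   by atomicity, as no [y] in [F] lies below [x]. *)
pose FF := filter_from F (fun y => atoms_below y `\` atoms_below x).
have FF_proper : ProperFilter FF.
  apply: filter_from_proper => [|y Fy].
    apply: filter_from_filter; first by exists \top.
    move=> y z Fy Fz; exists (y `&` z); first exact: FI.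
    by move=> a [[aa]]; rewrite lexI => /andP[ay az] nax; split; split.
  have : y `&` ~` x <> \bot.
    by move/eqP; rewrite disj_leC complK => yx; apply: Fx; exact: FS yx Fy.
  move=> /Batomic[a aa]; rewrite lexI => /andP[ay aCx].
  exists a; split=> // -[_ ax]; case: aa => aN0 _; apply: aN0; apply/eqP.
  by rewrite -lex0 -(meetxC x) lexI ax.
have [G [GU FG]] := ultraFilterLemma FF_proper.
have GE y : F y -> G (atoms_below y `\` atoms_below x).
  by move=> Fy; apply: FG; exists y.
have G0 : ~ G set0 by exact: filter_not_empty.
exists (fun y => G (atoms_below y)).
  split.
  - by apply: filterS (GE _ F1) => a [].
  - move=> G'; apply: G0; apply: filterS G' => a [[aN0 _]].
    by rewrite lex0 => /eqP.
  - move=> y z; split=> [Gyz|[Gy Gz]].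
      by split; apply: filterS Gyz => a [aa]; rewrite lexI => /andP[].
    apply: filterS (filterI Gy Gz) => a [[aa ay] [_ az]].
    by split=> //; rewrite lexI ay.
  - move=> y z Gyz; have [|GCy] := in_ultra_setVsetC (atoms_below y) GU; first by left.
    right; apply: filterS (filterI Gyz GCy) => a [[aa ayz] nay]; split=> //.
    have [ay|aCy] := atom_le_or_compl y aa; first by case: nay.
    by rewrite -[a](meet_l aCy) -diffE leBLR.
split=> [y Fy|Gx]; first by apply: filterS (GE _ Fy) => a [].
by apply: G0; apply: filterS (filterI Gx (GE _ F1)) => a [ax [_ []]].
Qed.

End PrimeFilters.

(** * The space of pairs of an atom and a prime filter *)

Section AtomicSpatial.
Context d (B : ctbDistrLatticeType d) (B_complete : complete_lattice B).
Implicit Types (f g h : necessity_operator B) (S : set (necessity_operator B)).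
Implicit Types a b c e x y z : B.

Record npoint := NPoint {
  npoint_atom : B;
  npoint_filter : set B;
  npoint_atomP : atom npoint_atom;
  npoint_filterP : prime_filter npoint_filter }.

HB.instance Definition _ := gen_eqMixin npoint.
HB.instance Definition _ := gen_choiceMixin npoint.

Definition nopen f : set npoint :=
  [set p | exists2 y, ~ npoint_filter p y & npoint_atom p <= f y].

Lemma nopen_homo f g : f <= g -> nopen f `<=` nopen g.
Proof.
move=> /necessity_leP fg p [y Uy afy]; exists y => //.
exact: le_trans afy (fg y).
Qed.

(** If [f x] is not below [g x], some atom [a] is below [f x] but not below [g x]. A prime filter
    containing all [y] with [a <= g y] but not [x] gives, with [a], a point separating [f] from
    [g]. *)
Lemma nopen_le f g : atomic B -> nopen f `<=` nopen g -> f <= g.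
Proof.
move=> Batomic fg; apply/necessity_leP => x.
apply: contrapT => /negP nle.
have : f x `&` ~` g x <> \bot by move/eqP; rewrite disj_leC complK (negbTE nle).
move=> /Batomic[a aa]; rewrite lexI => /andP[af aCg].
have [||||U Up [FU Ux]] :=
  @prime_filter_avoiding _ _ [set y | a <= g y] x Batomic => /=.
- by rewrite necessity1 lex1.
- by move=> y z ay az; rewrite necessityI lexI ay.
- by move=> y z yz /le_trans; apply; exact: necessity_homo.
- move=> ag; case: aa => + _; apply; apply/eqP.
  by rewrite -lex0 -(meetxC (g x)) lexI ag.
have [|y Uy ay] := fg (NPoint aa Up); first by exists x.
by apply: Uy; exact: FU.
Qed.

Lemma nopen_top : nopen ntop = setT.
Proof.
rewrite -subTset => p _; have [_ U0 _ _] := npoint_filterP p.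
exists \bot => //; apply: le_trans (le_step _ _ _).
by rewrite joinx0 lex1.
Qed.

Lemma nopen_meet f g : nopen (nmeet f g) = nopen f `&` nopen g.
Proof.
apply/seteqP; split=> [p [y Uy]|p [[y Uy ay] [z Uz az]]].
  by rewrite lexI => /andP[? ?]; split; exists y.
(* Primeness keeps the join of [y] and [z] outside the filter. *)
have [_ _ _ UU] := npoint_filterP p; exists (y `|` z); first by case/UU.
by rewrite /= lexI (le_trans ay) ?(le_trans az) ?necessity_homo ?leUl ?leUr.
Qed.

(** A filter omitting a finite meet omits one of its factors. *)
Lemma nopen_join_term S p y c :
  join_term S y c -> ~ npoint_filter p y -> npoint_atom p <= c ->
  exists2 f, S f & nopen f p.
Proof.
have [U1 _ UI _] := npoint_filterP p.
elim=> [//|f b y' c' Sf _ IH nU]; rewrite lexI => /andP[ab ac].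
have [Ub|nUb] := pselect (npoint_filter p b); last by exists f => //; exists b.
by apply: IH => // Uy; apply: nU; apply/UI.
Qed.

Lemma nopen_sup S : nopen (nsup B_complete S) = \bigcup_(f in S) nopen f.
Proof.
apply/seteqP; split=> [p [x Ux ax]|p [f Sf]]; last first.
  by apply: nopen_homo; exact: (nsupP B_complete S).1.
have [_ _ UI _] := npoint_filterP p.
(* An atom below a supremum is below one of its terms: otherwise it would meet every term in [\bot]
   and so be [\bot] by distributivity. *)
have [c [[y yx Sc] ac]] : exists c,
    (exists2 y, y <= x & join_term S y c) /\ npoint_atom p <= c.
  apply: contrapT => no; case: (npoint_atomP p) => + _; apply; apply/eqP.
  rewrite -lex0 -[leLHS](meet_l ax); apply: meet_bsup_le => // c Sc.
  have [ac|aCc] := atom_le_or_compl c (npoint_atomP p).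
    by case: no; exists c.
  by rewrite -(meetCx c) leI2.
apply: (nopen_join_term Sc) ac => Uy; apply: Ux.
by move: Uy; rewrite -(meet_l yx) => /UI[].
Qed.

Lemma atomic_spatial : atomic B -> spatial (necessity_operator B).
Proof.
(* The sets [nopen f] already form a topology, so every open set has this form by definition. *)
move=> Batomic; pose op := [set A | exists f, nopen f = A].
have opT : op setT by exists ntop; exact: nopen_top.
have opI : setI_closed op.
  by move=> _ _ [f <-] [g <-]; exists (nmeet f g); exact: nopen_meet.
have opU I (F : I -> set npoint) : (forall i, op (F i)) -> op (\bigcup_i F i).
  (* Taking all operators that represent some [F i] avoids choosing one for each [i]. *)
  move=> opF; exists (nsup B_complete [set f | exists i, nopen f = F i]).
  rewrite nopen_sup; apply/seteqP; split=> [p [f [i fE] fp]|p [i _ Fp]].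
    by exists i => //; rewrite -fE.
  by have [f fE] := opF i; exists f; [exists i | rewrite fE].
pose X : topologicalType := HB.pack_for topologicalType npoint
  (@isOpenTopological.Build npoint op opT opI opU).
exists X, nopen; split=> [f g|f|U //]; last by exists f.
by split; [exact: nopen_homo | exact: nopen_le].
Qed.

End AtomicSpatial.

Theorem corollary3p10 (d : Order.disp_t) (B : ctbDistrLatticeType d)
    (B_complete : complete_lattice B) :
  [/\ is_frame (necessity_operator B),
      zero_dimensional (necessity_operator B)
    & spatial (necessity_operator B) <-> atomic B].
Proof.
split; [exact: necessity_frame | exact: necessity_zero_dimensional |].
by split; [exact: spatial_atomic | exact: atomic_spatial].
Qed.
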